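(* Let $(X_a)_{a\in\mathcal A}$ be real-valued random variables with finite moments of all orders, and let $\mu,\kappa\in H^*$ be the moment and cumulant functionals, $\mu(A)=\mathbb{E}(X^A)$ and $\kappa(A)=\mathbf{E}_c(X_A)$ for $A\in\mathcal M(\mathcal A)$. Then $$\kappa=\log^\star(\mu)=\sum_{n\ge 1}\frac{(-1)^{n-1}}{n}\,(\mu-\varepsilon)^{\star n}.$$
   Context: $(X_a)_{a\in\mathcal A}$ are defined on a common probability space. $\mathcal M(\mathcal A)$ is the set of finitely supported functions $\mathcal A\to\mathbb{N}=\{0,1,2,\dots\}$, a commutative monoid for $(A\cdot B)(a):=A(a)+B(a)$ with neutral element the zero function $\emptyset$; $|B|:=\sum_aB(a)$. For $B\in\mathcal M(\mathcal A)$, $X^B:=\prod_{a:B(a)>0}X_a^{B(a)}$, $X^\emptyset:=1$. For $B,B_1,\dots,B_n\in\mathcal M(\mathcal A)$, $\binom{B}{B_1\dots B_n}:=\mathbf 1_{(B_1\cdots B_n=B)}\prod_{a}\frac{B(a)!}{B_1(a)!\cdots B_n(a)!}$. The cumulants $\mathbf{E}_c(X_B)$, $B\in\mathcal M(\mathcal A)$, are defined inductively over $|B|$ by $\mathbf{E}_c(X_\emptyset)=0$ and, for $B\ne\emptyset$, $$\mathbb{E}(X^B)=\sum_{n=1}^{|B|}\frac1{n!}\sum_{B_1,\dots,B_n\in\mathcal M(\mathcal A)\setminus\{\emptyset\}}\binom{B}{B_1\dots B_n}\prod_{i=1}^n\mathbf{E}_c(X_{B_i}).$$ $H$ is the real vector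 space freely generated by $\mathcal M(\mathcal A)$, with coproduct $\Delta A:=\sum_{B_1,B_2\in\mathcal M(\mathcal A)}\binom{A}{B_1\,B_2}B_1\otimes B_2$ and counit $\varepsilon(A)=\mathbf 1_{(A=\emptyset)}$ for $A\in\mathcal M(\mathcal A)$. The convolution product on $H^*$ is $(f\star g)(A):=(f\otimes g)\Delta A$, with unit $\varepsilon$; superscript $\star n$ denotes the $n$-fold convolution power. The infinite sum is pointwise: on any element of $H$ only finitely many terms are nonzero. *)

(* Defs.v *)
From HB Require Import structures.
From mathcomp Require Import all_boot all_order all_algebra.
From mathcomp Require Import finmap.
From mathcomp Require Import monalg.
From mathcomp Require Import all_classical all_reals all_analysis.

Set Implicit Arguments.
Unset Strict Implicit.
Unset Printing Implicit Defensive.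

Import Order.TTheory GRing.Theory Num.Theory.

Local Open Scope classical_set_scope.
Local Open Scope ring_scope.

(* The monoid of finitely supported functions A -> nat is {cmonom A}, with
   product mmul (pointwise addition of exponents), unit mone and degree mdeg.
   The vector space freely generated by a set K is {malg R[K]}, in which << k >>
   is the basis vector k; the dual of a space U is {scalar U}.
   The sums \sum_(i \in D) over infinite D (from fsbigop) are 0 by convention on
   families with infinite support; the families summed in coproduct and
   cumulant_term always have finite support. *)

Section FreeModule.
Context {R : comNzRingType} {K : choiceType}.

Definition linext {V : lmodType R} (f : K -> V) (h : {malg R[K]}) : V :=
  \sum_(k <- msupp h) h@_k *: f k.

Lemma linextEw {V : lmodType R} (f : K -> V) (h : {malg R[K]}) (D : {fset K}) :
  (msupp h `<=` D)%fset -> linext f h = \sum_(k <- D) h@_k *: f k.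
Proof.
move=> hD; rewrite /linext (big_fset_incl _ hD)//.
by move=> k _ /mcoeff_outdom ->; rewrite scale0r.
Qed.

Lemma linext_is_linear {V : lmodType R} (f : K -> V) : linear (linext f).
Proof.
move=> c g h; pose D := (msupp g `|` msupp h `|` msupp (c *: g + h))%fset.
have hg : (msupp g `<=` D)%fset by rewrite /D -fsetUA fsubsetUl.
have hh : (msupp h `<=` D)%fset.
  by apply: (fsubset_trans (fsubsetUr (msupp g) _)); rewrite fsubsetUl.
have hgh : (msupp (c *: g + h) `<=` D)%fset by rewrite fsubsetUr.
rewrite (linextEw _ hg) (linextEw _ hh) (linextEw _ hgh).
rewrite scaler_sumr -big_split/=; apply: eq_bigr => k _.
by rewrite mcoeffD mcoeffZ scalerDl scalerA.
Qed.

HB.instance Definition _ {V : lmodType R} (f : K -> V) :=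
  GRing.isLinear.Build R {malg R[K]} V *:%R (linext f) (linext_is_linear f).

Definition dualext (f : K -> R) : {scalar {malg R[K]}} :=
  (linext (f : K -> R^o) : {linear {malg R[K]} -> R^o}).

Lemma linextU {V : lmodType R} (f : K -> V) (k : K) : linext f << k >> = f k.
Proof.
by rewrite (linextEw _ msuppU_le) big_seq_fset1 mcoeffUU scale1r.
Qed.

Lemma dualextU (f : K -> R) (k : K) : dualext f << k >> = f k.
Proof. exact: (linextU (f : K -> R^o)). Qed.

End FreeModule.

(* For a outside the support of B the factor is 1 whenever the indicator is 1,
   so the product over all a reduces to the product over the support of B. *)
Definition multinom {R : realType} {A : choiceType}
    (B : {cmonom A}) (Bs : seq {cmonom A}) : R :=
  (\big[mmul/mone]_(C <- Bs) C == B)%:R *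
  \prod_(a <- finsupp B) ((B a)`!%:R / \prod_(C <- Bs) (C a)`!%:R).

Section Hopf.
Context {R : realType} {A : choiceType}.

Local Notation M := {cmonom A}.
Local Notation H := {malg R[M]}.
(* H (x) H is modelled as the space freely generated by pairs of basis vectors
   of H, with B1 (x) B2 = << (B1, B2) >>. *)
Local Notation HH := {malg R[(M * M)%type]}.

Definition coproduct : {linear H -> HH} :=
  linext (fun B : M =>
    \sum_(p \in [set: (M * M)%type]) multinom B [:: p.1; p.2] *: (<< p >> : HH)).

Definition counit : {scalar H} := dualext (fun B : M => (B == mone)%:R).

Definition tensor (f g : {scalar H}) : {scalar HH} :=
  dualext (fun p : M * M => f << p.1 >> * g << p.2 >>).

Definition conv (f g : {scalar H}) : {scalar H} := tensor f g \o coproduct.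

Definition convpow (f : {scalar H}) (n : nat) : {scalar H} :=
  iter n (conv f) counit.

Definition logstar (f : {scalar H}) (h : H) : R :=
  \sum_(n \in [set n | (1 <= n)%N])
    (-1) ^+ n.-1 / n%:R * convpow (f \- counit) n h.

End Hopf.

Section Cumulants.
Context {R : realType} {A : choiceType}.

Local Notation M := {cmonom A}.

Definition cumulant_term (c : M -> R) (B : M) (n : nat) : R :=
  n`!%:R^-1 *
  \sum_(Bs \in [set Bs : n.-tuple M | forall i, tnth Bs i != mone])
    multinom B Bs * \prod_(i < n) c (tnth Bs i).

Definition cumulants_of (m c : M -> R) : Prop :=
  c mone = 0 /\
  forall B, B != mone ->
    m B = \sum_(1 <= n < (mdeg B).+1) cumulant_term c B n.

(* The defining relation solved for its term n = 1, which is c B; the terms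
   with n >= 2 only involve values of c in degree less than mdeg B. *)
Fixpoint cumulant_rec (m : M -> R) (k : nat) (B : M) : R :=
  if k is k'.+1 then
    if B == mone then 0
    else m B - \sum_(2 <= n < (mdeg B).+1) cumulant_term (cumulant_rec m k') B n
  else 0.

Definition cumulant_of (m : M -> R) (B : M) : R := cumulant_rec m (mdeg B) B.

Lemma multinom_neq0_prod (B : M) (Bs : seq M) :
  multinom B Bs != 0 :> R -> \big[mmul/mone]_(C <- Bs) C = B.
Proof. by rewrite /multinom; case: (_ =P B) => // _; rewrite mul0r eqxx. Qed.

Lemma multinom1 (B : M) : multinom B [:: B] = 1 :> R.
Proof.
rewrite /multinom big_seq1 eqxx mul1r big1// => a _.
by rewrite big_seq1 divff// pnatr_eq0 -lt0n fact_gt0.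
Qed.

Lemma cumulant_term1 (c : M -> R) (B : M) : B != mone ->
  cumulant_term c B 1 = c B.
Proof.
move=> B1; rewrite /cumulant_term invr1 mul1r.
rewrite -(@fsbig_widen _ _ _ _ [set [tuple B]]).
- by rewrite fsbig_set1 big_ord_recl big_ord0 mulr1 multinom1 mul1r tnth0.
- by move=> _ -> i; rewrite ord1 tnth0.
- move=> t [_ /= tB]; apply/eqP; apply: contra_notT tB => tB.
  have {}tB : multinom B t != 0 :> R.
    by apply: contraNneq tB => ->; rewrite mul0r.
  have := multinom_neq0_prod tB.
  by case/tupleP: t tB => C t _; rewrite tuple0 big_seq1 => ->.
Qed.

Lemma mdeg_tnth_lt (B : M) (n : nat) (Bs : n.-tuple M) (i : 'I_n) :
  (2 <= n)%N -> (forall j, tnth Bs j != mone) ->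
  \big[mmul/mone]_(C <- Bs) C = B -> (mdeg (tnth Bs i) < mdeg B)%N.
Proof.
move=> n2 Bs1 <-; rewrite mdeg_prod big_tuple (bigD1 i)//=.
have [j ji] : exists j : 'I_n, j != i.
  case: n n2 Bs i Bs1 => [|[|n]]// _ _ i _.
  have [->|i0] := eqVneq i ord0; first by exists ord_max.
  by exists ord0; rewrite eq_sym.
rewrite (bigD1 j)//= -[ltnLHS]addn0 ltn_add2l ltn_addr// lt0n.
by apply: contraNneq (Bs1 j) => /mdeg_eq0I ->.
Qed.

Lemma eq_cumulant_term (c c' : M -> R) (B : M) (n : nat) : (2 <= n)%N ->
  (forall C, (mdeg C < mdeg B)%N -> c C = c' C) ->
  cumulant_term c B n = cumulant_term c' B n.
Proof.
move=> n2 cc'; congr (_ * _); apply: eq_fsbigr => t; rewrite inE => t1.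
have [->|/multinom_neq0_prod tB] := eqVneq (multinom B t : R) 0.
  by rewrite !mul0r.
by congr (_ * _); apply: eq_bigr => i _; apply/cc'/mdeg_tnth_lt.
Qed.

Lemma mdeg_gt0 (B : M) : B != mone -> (0 < mdeg B)%N.
Proof. by rewrite lt0n; apply: contra_neq => /mdeg_eq0I. Qed.

Lemma cumulant_rec_stable (m : M -> R) (k k' : nat) (B : M) :
  (mdeg B <= k)%N -> (mdeg B <= k')%N ->
  cumulant_rec m k B = cumulant_rec m k' B.
Proof.
elim: k k' B => [|k ih] [|k'] B //=.
- by rewrite leqn0 => /eqP/mdeg_eq0I ->; rewrite eqxx.
- by move=> _; rewrite leqn0 => /eqP/mdeg_eq0I ->; rewrite eqxx.
move=> Bk Bk'; case: ifPn => // B1; congr (_ - _).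
apply: eq_big_nat => n /andP[n2 _]; apply: eq_cumulant_term => // C CB.
by apply: ih; rewrite -ltnS; exact: leq_trans CB _.
Qed.

Lemma cumulant_ofP (m : M -> R) : cumulants_of m (cumulant_of m).
Proof.
split=> [|B B1]; first by rewrite /cumulant_of mdeg1.
rewrite big_ltn ?ltnS ?mdeg_gt0// cumulant_term1//.
have -> : cumulant_of m B =
    m B - \sum_(2 <= n < (mdeg B).+1) cumulant_term (cumulant_of m) B n.
  rewrite {1}/cumulant_of; case Bk : (mdeg B) (mdeg_gt0 B1) => [//|k] _ /=.
  rewrite (negbTE B1) Bk; congr (_ - _).
  apply: eq_big_nat => n /andP[n2 _]; apply: eq_cumulant_term => // C.
  by rewrite Bk ltnS => Ck; exact: cumulant_rec_stable.
by rewrite subrK.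
Qed.

Lemma cumulants_of_unique (m c c' : M -> R) :
  cumulants_of m c -> cumulants_of m c' -> c = c'.
Proof.
move=> [c1 cE] [c'1 c'E]; apply/funext => B.
have [k] := ubnP (mdeg B); elim: k B => // k ih B; rewrite ltnS => Bk.
have [->|B1] := eqVneq B mone; first by rewrite c1 c'1.
have := cE _ B1; rewrite (c'E _ B1) big_ltn ?ltnS ?mdeg_gt0// cumulant_term1//.
rewrite [RHS]big_ltn ?ltnS ?mdeg_gt0// cumulant_term1//.
have -> : \sum_(2 <= n < (mdeg B).+1) cumulant_term c B n =
          \sum_(2 <= n < (mdeg B).+1) cumulant_term c' B n.
  apply: eq_big_nat => n /andP[n2 _]; apply: eq_cumulant_term => // C CB.
  exact/ih/(leq_trans CB).
by move/addIr.
Qed.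

End Cumulants.

Section Functionals.
Context {d : measure_display} {T : measurableType d} {R : realType}.
Context (P : probability T R) {A : choiceType} (X : A -> {RV P >-> R}).

Definition moment (B : {cmonom A}) : R :=
  fine 'E_P[fun w => \prod_(a <- finsupp B) X a w ^+ B a].

Definition cumulant (B : {cmonom A}) : R := cumulant_of moment B.

Definition moment_functional : {scalar {malg R[{cmonom A}]}} := dualext moment.

Definition cumulant_functional : {scalar {malg R[{cmonom A}]}} :=
  dualext cumulant.

End Functionals.

(* Main.v *)
Require Import Defs.
From HB Require Import structures.
From mathcomp Require Import all_boot all_order all_algebra.
From mathcomp Require Import finmap.
From mathcomp Require Import monalg.
From mathcomp Require Import ring.
From mathcomp Require Import all_classical all_reals all_analysis.

(* For a finite set D of monomials closed under divisors, attach to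
   f : M -> R the polynomial egf D f = sum_(C in D) (f(C) / C!) C, where C! is the product of
   the C(a)! over the support of C. On monomials
   of D, convolution of functionals becomes multiplication of polynomials, and
   the recursion defining the cumulants says that mu - epsilon is the truncated
   series sum_(1 <= n <= N) K^n / n! of K = egf D kappa. The claim thus reduces
   to the congruence log(exp X) = X modulo X^(N+1) between truncated one-variable
   series, because K has no constant term. *)

Set Implicit Arguments.
Unset Strict Implicit.
Unset Printing Implicit Defensive.

Import Order.TTheory GRing.Theory Num.Theory.

Local Open Scope classical_set_scope.
Local Open Scope ring_scope.

(** * Truncated exponential and logarithm in one variable *)

Section TruncatedSeries.
Context {R : numFieldType}.

Definition exp_trunc (N : nat) : {poly R} :=
  \sum_(i < N) i.+1`!%:R^-1 *: 'X^(i.+1).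

Definition log_trunc (N : nat) : {poly R} :=
  \sum_(i < N) ((-1) ^+ i / i.+1%:R) *: 'X^(i.+1).

(** Termwise differentiation gives the geometric sum of the powers [(- 'X) ^+ i], which telescopes
    against [1 + 'X]. *)
Lemma deriv_log_trunc (N : nat) :
  (1 + 'X) * (log_trunc N)^`() = 1 - (- 'X) ^+ N.
Proof.
have -> : (log_trunc N)^`() = \sum_(i < N) (- 'X) ^+ i.
  rewrite /log_trunc raddf_sum; apply: eq_bigr => i _ /=.
  rewrite derivZ derivXn -scaler_nat scalerA divfK ?pnatr_eq0//.
  by rewrite -scaleN1r exprZn.
have := subrX1 (- 'X : {poly R}) N; move: (\sum_(_ < _) _) => S E.
by rewrite -[1 - _]opprB E -mulNr opprB opprK.
Qed.

Lemma deriv_exp_trunc (N : nat) :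
  (exp_trunc N)^`() = 1 + exp_trunc N - N`!%:R^-1 *: 'X^N.
Proof.
have -> : 1 + exp_trunc N = \sum_(i < N.+1) i`!%:R^-1 *: 'X^i.
  by rewrite big_ord_recl fact0 invr1 scale1r.
rewrite big_ord_recr/= addrK /exp_trunc raddf_sum; apply: eq_bigr => i _ /=.
rewrite derivZ derivXn -scaler_nat scalerA factS natrM invfM mulrAC.
by rewrite mulVf ?pnatr_eq0// mul1r.
Qed.

Lemma dvd_exp_trunc (N : nat) : exists Q : {poly R}, exp_trunc N = 'X * Q.
Proof.
exists (\sum_(i < N) i.+1`!%:R^-1 *: 'X^i); rewrite mulr_sumr.
by apply: eq_bigr => i _; rewrite -scalerAr exprS.
Qed.

(* The derivative of [log_trunc N \Po exp_trunc N] is 1 modulo ['X^N]. *)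
Lemma log_exp_trunc (N : nat) : exists Q : {poly R},
  log_trunc N \Po exp_trunc N = 'X + Q * 'X^(N.+1).
Proof.
set E := exp_trunc N; set L := log_trunc N; pose D := (L \Po E) - 'X.
have [F EF] := dvd_exp_trunc N; rewrite -/E in EF.
have [Q' DQ'] : exists Q, D^`() = Q * 'X^N.
  (* By the chain rule [D'] is [L'(E) * (1 + E - X^N / N!) - 1], and
     [L'(E) * (1 + E) = 1 - (- E)^N]. The witness is what remains after taking [X^N] out, using
     [E = X * F]. *)
  exists (- (- F) ^+ N - N`!%:R^-1 *: (L^`() \Po E)).
  rewrite /D derivB derivX deriv_comp deriv_exp_trunc -/E mulrBr.
  have : ((1 + 'X) * L^`()) \Po E = (1 - (- 'X) ^+ N) \Po E.
    by rewrite deriv_log_trunc.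
  rewrite comp_polyM comp_polyB comp_polyD comp_polyC comp_polyX.
  have -> : (- 'X) ^+ N \Po E = (- E) ^+ N.
    by rewrite -scaleN1r exprZn comp_polyZ comp_Xn_poly -exprZn scaleN1r.
  rewrite !polyC1 mulrC => ->; rewrite EF -[- ('X * F)]mulrN exprMn.
  by rewrite -scalerAr mulrBl -scalerAl exprNn; ring.
(* The constant term vanishes because [L] and [E] have none; in characteristic 0 the other
   coefficients are read off from [D']. *)
have D0 i : (i < N.+1)%N -> D`_i = 0.
  case: i => [_|i iN].
    rewrite -horner_coef0 /D hornerD hornerN horner_comp EF hornerM hornerX.
    rewrite mul0r subr0 /L horner_sum big1// => j _.
    by rewrite hornerZ hornerXn expr0n mulr0.
  have := coef_deriv D i; rewrite DQ' coefMXn -ltnS iN => /esym/eqP.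
  by rewrite mulrn_eq0 => /eqP.
exists (drop_poly N.+1 D).
have := poly_take_drop N.+1 D.
have -> : take_poly N.+1 D = 0.
  by apply/polyP => i; rewrite coef_take_poly coef0; case: ltnP => // /D0.
by rewrite add0r => ->; rewrite /D addrC subrK.
Qed.

End TruncatedSeries.

(** * Monomials, their divisors and exponential generating functions *)

Section ExponentialGeneratingFunction.
Context {R : realType} {A : choiceType}.

Local Notation M := {cmonom A}.
Local Notation H := {malg R[M]}.
Implicit Types (B C : M) (D : {fset M}) (c : M -> R).

(** A divisor of [B] vanishes off the support of [B] and has exponents at most [mdeg B], so it lies
    in the image of a finite function type. *)
Lemma finite_divisors B : finite_set [set C | exists C', mmul C C' = B].
Proof.
pose g (f : {ffun finsupp B -> 'I_(mdeg B).+1}) : M :=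
  mkcmonom [fsfun a : finsupp B => (f a : nat) | 0%N]%M.
apply: (sub_finite_set _ (finite_image g (@finite_finset _ setT))) => C [C' CB] /=.
exists [ffun a => inord (C (val a))] => //.
apply/eqP/cmP => a; rewrite cmE /= fsfun_ffun.
case: insubP => [u ua <-|]/=; last first.
  by rewrite -cmE_eq0 -CB cmM addn_eq0 => /andP[/eqP ->].
rewrite ffunE inordK// ltnS; have := congr1 mdeg CB; rewrite mdegM => <-.
apply: leq_trans (leq_addr _ _).
case: (mdomP C (val u)) => // uC.
by rewrite mdegE (big_fsetD1 (val u))//= leq_addr.
Qed.

Definition divisors B : {fset M} := fset_set [set C | exists C', mmul C C' = B].

Lemma divisorsP B C : C \in divisors B <-> exists C', mmul C C' = B.
Proof. by rewrite in_fset_set ?inE//; exact: finite_divisors. Qed.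

(** Every factorisation of a monomial of [D] then stays inside [D], on both sides by
    commutativity. *)
Definition divisor_closed D := forall C C', mmul C C' \in D -> C \in D.

Lemma divisors_closed B : divisor_closed (divisors B).
Proof.
move=> C C' /divisorsP[C'' <-]; apply/divisorsP.
by exists (mmul C' C''); rewrite mulmA.
Qed.

Lemma mem_divisors B : B \in divisors B.
Proof. by apply/divisorsP; exists mone; rewrite mulm1. Qed.

Definition mfact B : R := \prod_(a <- finsupp B) (B a)`!%:R.

Lemma mfact_neq0 B : mfact B != 0.
Proof.
by rewrite prodf_seq_neq0; apply/allP => a _; rewrite pnatr_eq0 -lt0n fact_gt0.
Qed.

Lemma mfactEw B (d : {fset A}) : (finsupp B `<=` d)%fset ->
  mfact B = \prod_(a <- d) (B a)`!%:R.
Proof.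
move=> Bd; rewrite /mfact (big_fset_incl _ Bd)// => a _.
by rewrite -cmE_eq0 => /eqP ->.
Qed.

(** When the indicator is 1, each entry of [Bs] is supported inside [B], so the product over the
    support of [B] splits into full factorials. *)
Lemma multinomE B (Bs : seq M) : multinom B Bs =
  (\big[mmul/mone]_(C <- Bs) C == B)%:R * (mfact B / \prod_(C <- Bs) mfact C).
Proof.
rewrite /multinom; case: eqP => [BsB|]; last by rewrite !mul0r.
rewrite !mul1r prodf_div; congr (_ / _); rewrite exchange_big/=.
apply: eq_big_seq => C CBs; rewrite -mfactEw// -BsB (big_rem C)//= mdomD.
exact: fsubsetUl.
Qed.

Definition egf D c : H := \sum_(C <- D) << c C / mfact C *g C >>.

Lemma mcoeff_egf D c C : (egf D c)@_C = (c C / mfact C) *+ (C \in D).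
Proof.
rewrite /egf raddf_sum; under eq_bigr => C' _ do rewrite /= mcoeffU.
case: (boolP (C \in D)) => CD; last first.
  by rewrite big_seq big1// => C' C'D; case: eqP C'D CD => // -> ->.
rewrite (big_fsetD1 C)//= eqxx.
rewrite big_seq big1 ?addr0// => C'.
by rewrite !inE => /andP[/negbTE ->].
Qed.

Lemma malgMUU (x y : R) B C :
  << x *g B >> * << y *g C >> = << x * y *g mmul B C >> :> H.
Proof. by rewrite malgM_def fgmulUU. Qed.

Lemma conv_egf D (f g : {scalar H}) B : divisor_closed D -> B \in D ->
  Defs.conv f g << B >> =
  mfact B * (egf D (fun C => f << C >>) * egf D (fun C => g << C >>))@_B.
Proof.
move=> Dc BD; rewrite /Defs.conv /= /coproduct /= linextU.
pose r := [seq (C, C') | C <- enum_fset D, C' <- enum_fset D].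
(* A nonzero coefficient forces [C * C' = B], so only pairs from [D] contribute. *)
rewrite -(fsbig_widen [set` r])//; last first.
  move=> [C C'] [_ /= CC']; apply/eqP; rewrite scaler_eq0; apply/orP; left.
  apply: contra_notT CC' => /multinom_neq0_prod; rewrite !big_cons big_nil mulm1.
  move=> CB; apply/allpairsP; exists (C, C'); split => //=.
    by apply: (Dc _ C'); rewrite CB.
  by apply: (Dc _ C); rewrite mulmC CB.
rewrite -fsbig_seq; last first.
  by apply: allpairs_uniq; rewrite ?fset_uniq// => -[? ?] [? ?].
rewrite big_allpairs_dep /= linear_sum /= /egf mulr_suml raddf_sum mulr_sumr.
apply: eq_bigr => C _; rewrite linear_sum mulr_sumr raddf_sum mulr_sumr.
apply: eq_bigr => C' _; rewrite scalarZ /= dualextU/= malgMUU mcoeffU multinomE.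
rewrite !big_cons !big_nil mulm1 mulr1 -[in RHS]mulr_natl.
move: (f _) (g _) (_ == B) => x y b.
rewrite !invfM; move: (mfact B) (_^-1) (_^-1) => u v w; move: b%:R => z.
ring.
Qed.

Lemma malg_prodU (I : Type) (r : seq I) (x : I -> R) (C : I -> M) :
  \prod_(i <- r) << x i *g C i >> =
  << \prod_(i <- r) x i *g \big[mmul/mone]_(i <- r) C i >> :> H.
Proof.
elim: r => [|i r ih]; first by rewrite !big_nil.
by rewrite !big_cons ih; exact: malgMUU.
Qed.

Lemma cumulant_term_egf D c B n : divisor_closed D -> B \in D -> c mone = 0 ->
  cumulant_term c B n = n`!%:R^-1 * (mfact B * (egf D c ^+ n)@_B).
Proof.
move=> Dc BD c1; rewrite /cumulant_term; congr (_ * _).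
(* Tuples with an empty entry may be added, since [c mone = 0] kills their terms. *)
rewrite (fsbig_widen _ setT)//; last first.
  move=> t [_ /= /existsNP[i]] /negP; rewrite negbK => /eqP ti.
  by rewrite (bigD1 i)//= ti c1 mul0r mulr0.
pose h (f : {ffun 'I_n -> D}) : n.-tuple M := [tuple val (f i) | i < n].
have h_inj : injective h.
  move=> f f' ff'; apply/ffunP => i; apply: val_inj.
  by have := congr1 (fun t => tnth t i) ff'; rewrite !tnth_mktuple.
(* Conversely only tuples with entries in [D] matter; through [h] they are the choice functions that
   index the expansion of the [n]-th power. *)
rewrite -(fsbig_widen [set` map h (index_enum _)])//; last first.
  move=> t [_ /= th]; apply/eqP; rewrite mulf_eq0; apply/orP; left.
  apply: contra_notT th => /multinom_neq0_prod tB.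
  have tD i : tnth t i \in D.
    apply: (Dc _ (\big[mmul/mone]_(j < n | j != i) tnth t j)).
    by move: tB; rewrite big_tuple (bigD1 i)//= => ->.
  apply/mapP; exists [ffun i => FSetSub (tD i)]; first by rewrite mem_index_enum.
  by apply: eq_from_tnth => i; rewrite tnth_mktuple ffunE.
rewrite -fsbig_seq; last by rewrite map_inj_uniq// index_enum_uniq.
rewrite big_map.
have -> : egf D c ^+ n = \prod_(i < n) egf D c by rewrite prodr_const card_ord.
rewrite /egf big_seq_fsetE bigA_distr_bigA raddf_sum mulr_sumr.
apply: eq_bigr => f _; rewrite /= malg_prodU mcoeffU multinomE.
rewrite !(big_tuple _ _ (h f)).
have -> : \prod_(i < n) c (tnth (h f) i) = \prod_(i < n) c (val (f i)).
  by apply: eq_bigr => i _; rewrite tnth_mktuple.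
have -> : \prod_(i < n) mfact (tnth (h f) i) = \prod_(i < n) mfact (val (f i)) :> R.
  by apply: eq_bigr => i _; rewrite tnth_mktuple.
have -> : \big[mmul/mone]_(i < n) tnth (h f) i =
          \big[mmul/mone]_(i < n) (fsval (f i) : M).
  by apply: eq_bigr => i _; rewrite tnth_mktuple.
rewrite prodf_div -[in RHS]mulr_natl.
move: (_ == B) (\prod_(_ < n) c _) (\prod_(_ < n) mfact _) => b x y.
move: (mfact B) y^-1 b%:R => u v z.
ring.
Qed.

(** * Congruence on [D] and filtration by degree *)

(** Agreement on [D] is congruence modulo the span of the monomials outside [D], an ideal because
    [D] is closed under divisors. *)
Lemma eq_mcoeffM D (g g' h h' : H) : divisor_closed D ->
  {in D, forall C, g@_C = g'@_C} -> {in D, forall C, h@_C = h'@_C} ->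
  {in D, forall C, (g * h)@_C = (g' * h')@_C}.
Proof.
move=> Dc gg' hh' C CD.
rewrite [LHS](mcoeffMlw _ (fsubsetUl _ (msupp g')) (fsubsetUl _ (msupp h'))).
rewrite [RHS](mcoeffMlw _ (fsubsetUr (msupp g) _) (fsubsetUr (msupp h) _)).
apply: eq_bigr => C1 _; apply: eq_bigr => C2 _; case: eqP => // CE.
rewrite gg' ?hh'//; first by apply: (Dc _ C1); rewrite mulmC CE.
by apply: (Dc _ C2); rewrite CE.
Qed.

Lemma horner_algMXaddC (g : H) (p : {poly R}) (x : R) :
  horner_alg g (p * 'X + x%:P) = horner_alg g p * g + x%:A.
Proof. by rewrite rmorphD rmorphM /= horner_algX horner_algC. Qed.

Lemma eq_mcoeff_horner D (g g' : H) (p : {poly R}) : divisor_closed D ->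
  {in D, forall C, g@_C = g'@_C} ->
  {in D, forall C, (horner_alg g p)@_C = (horner_alg g' p)@_C}.
Proof.
move=> Dc gg'; elim/poly_ind: p => [|p x ih] C CD.
  by rewrite [in LHS]raddf0 [in RHS]raddf0.
rewrite [in LHS]horner_algMXaddC [in RHS]horner_algMXaddC.
rewrite [LHS]mcoeffD [RHS]mcoeffD.
have E := eq_mcoeffM Dc ih gg' CD.
exact: (congr1 (+%R^~ _) E).
Qed.

Lemma horner_alg_comp (g : H) (p q : {poly R}) :
  horner_alg g (p \Po q) = horner_alg (horner_alg g q) p.
Proof.
elim/poly_ind: p => [|p x ih].
  by rewrite comp_poly0 [LHS]raddf0 [RHS]raddf0.
rewrite [RHS]horner_algMXaddC comp_polyD comp_polyM comp_polyX comp_polyC.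
by rewrite [LHS]rmorphD [X in X + _ = _]rmorphM /= ih horner_algC.
Qed.

(** In any factorisation of [C], the left factor has degree below [m] or the right one has degree
    below [n]. *)
Lemma mcoeffM_order (g h : H) m n :
  (forall C, (mdeg C < m)%N -> g@_C = 0) ->
  (forall C, (mdeg C < n)%N -> h@_C = 0) ->
  forall C, (mdeg C < m + n)%N -> (g * h)@_C = 0.
Proof.
move=> g0 h0 C Cmn; rewrite mcoeffMl big1// => C1 _; rewrite big1// => C2 _.
case: eqP => // CE; have [/g0 ->|C1m] := ltnP (mdeg C1) m; first by rewrite mul0r.
rewrite h0 ?mulr0//; move: Cmn; rewrite -CE mdegM => Cmn.
by rewrite -(ltn_add2l (mdeg C1)) (leq_trans Cmn)// leq_add2r.
Qed.

Lemma mcoeffX_order (g : H) n : g@_mone = 0 ->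
  forall C, (mdeg C < n)%N -> (g ^+ n)@_C = 0.
Proof.
move=> g0; elim: n => // n ih C Cn; rewrite exprS.
apply: (@mcoeffM_order _ _ 1 n) => // C'; rewrite ltnS leqn0.
by move=> /eqP/mdeg_eq0I ->.
Qed.

(** * Convolution powers and the logarithm formula on monomials *)

Lemma convpow_egf D (f : {scalar H}) n : divisor_closed D ->
  {in D, forall C, convpow f n << C >> =
    mfact C * (egf D (fun C => f << C >>) ^+ n)@_C}.
Proof.
move=> Dc; elim: n => [|n ih] C CD.
  rewrite expr0 mcoeff1 /convpow /= /counit dualextU.
  by case: eqP => [->|]; rewrite ?mulr0// mulr1 /mfact mdom1 big_seq_fset0.
rewrite /convpow iterS -/(convpow f n) (conv_egf _ _ Dc CD) exprS.
(* The power of [egf] may have monomials outside [D], so the induction hypothesis gives agreement on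
   [D] only, which products respect. *)
apply: (congr1 ( *%R (mfact C))); apply: (eq_mcoeffM Dc) CD => // C' C'D.
rewrite mcoeff_egf C'D ih// mulr1n mulrAC divff ?mul1r//; exact: mfact_neq0.
Qed.

Lemma convpow_order (f : {scalar H}) n C : f << mone >> = 0 ->
  (mdeg C < n)%N -> convpow f n << C >> = 0.
Proof.
move=> f1 Cn.
rewrite (convpow_egf _ _ (divisors_closed (B := C))) ?mem_divisors//.
by rewrite mcoeffX_order ?mulr0// mcoeff_egf f1 mul0r mul0rn.
Qed.

Lemma horner_exp_trunc (g : H) N :
  horner_alg g (exp_trunc N) = \sum_(1 <= n < N.+1) n`!%:R^-1 *: g ^+ n.
Proof.
rewrite /exp_trunc raddf_sum big_add1 /= big_mkord; apply: eq_bigr => i _.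
by rewrite linearZ /= rmorphXn /= horner_algX mulr_algl.
Qed.

Lemma horner_log_trunc (g : H) N :
  horner_alg g (log_trunc N) =
  \sum_(1 <= n < N.+1) ((-1) ^+ n.-1 / n%:R) *: g ^+ n.
Proof.
rewrite /log_trunc raddf_sum big_add1 /= big_mkord; apply: eq_bigr => i _.
by rewrite linearZ /= rmorphXn /= horner_algX mulr_algl.
Qed.

(** [N] is any bound on the degree, so that one truncation can serve all monomials of a given
    element of [H]. *)
Lemma cumulant_log (m c : M -> R) B N : m mone = 1 -> cumulants_of m c ->
  (mdeg B <= N)%N ->
  c B = \sum_(1 <= n < N.+1)
    (-1) ^+ n.-1 / n%:R * convpow (dualext m \- counit) n << B >>.
Proof.
move=> m1 [c1 cE] BN.
set f : {scalar H} := dualext m \- counit.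
pose D := divisors B; have Dc : divisor_closed D := divisors_closed (B := B).
have BD : B \in D := mem_divisors B.
pose U := egf D (fun C => f << C >>); pose K := egf D c.
have K1 : K@_mone = 0 by rewrite mcoeff_egf c1 mul0r mul0rn.
have UK : {in D, forall C, U@_C = (horner_alg K (exp_trunc N))@_C}.
  move=> C CD; rewrite mcoeff_egf CD mulr1n horner_exp_trunc raddf_sum /=.
  rewrite /f /= /counit !dualextU; have [->|C1] := eqVneq C mone.
    rewrite m1 subrr mul0r big_nat big1 => [//|n /andP[n0 _]].
    by rewrite mcoeffZ (mcoeffX_order K1) ?mulr0 ?mdeg1.
  have CN : ((mdeg C).+1 <= N.+1)%N.
    rewrite ltnS (leq_trans _ BN)//; have /divisorsP[C' <-] := CD.
    by rewrite mdegM leq_addr.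
  (* The recursion stops at [n = mdeg C]; the terms from there up to [N] vanish because [K ^+ n] has
     no monomial of degree below [n]. *)
  rewrite subr0 cE// [RHS](big_cat_nat (ltn0Sn _) CN) /=.
  rewrite [X in _ + X]big_nat [X in _ + X]big1 ?addr0; last first.
    by move=> n /andP[Cn _]; rewrite mcoeffZ (mcoeffX_order K1) ?mulr0.
  rewrite mulr_suml; apply: eq_bigr => n _.
  rewrite (cumulant_term_egf _ Dc CD c1) mcoeffZ -/K -mulrA; congr (_ * _).
  by rewrite mulrAC divff ?mul1r// mfact_neq0.
transitivity (mfact B * (horner_alg U (log_trunc N))@_B); last first.
  rewrite horner_log_trunc raddf_sum mulr_sumr; apply: eq_bigr => n _ /=.
  by rewrite mcoeffZ mulrCA (convpow_egf _ _ Dc BD).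
rewrite (eq_mcoeff_horner _ Dc UK BD) -horner_alg_comp.
have [Q ->] := log_exp_trunc (R := R) N.
rewrite rmorphD rmorphM rmorphXn /= horner_algX mcoeffD.
(* The remainder is a multiple of [K ^+ N.+1], invisible at [B] since [mdeg B <= N]; only the
   coefficient of [K] is left. *)
rewrite (@mcoeffM_order _ _ 0 N.+1) ?addr0//; last exact: mcoeffX_order.
by rewrite mcoeff_egf BD mulr1n mulrC divfK// mfact_neq0.
Qed.

End ExponentialGeneratingFunction.

(** * Extension from monomials to all of [H] *)

Lemma scalar_malgE (R : realType) (K : choiceType) (phi : {scalar {malg R[K]}})
    (h : {malg R[K]}) :
  phi h = \sum_(k <- msupp h) h@_k * phi << k >>.
Proof.
rewrite [in LHS](monalgE h) linear_sum; apply: eq_bigr => k _.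
have -> : << h@_k *g k >> = h@_k *: << k >> :> {malg R[K]}.
  by apply/malgP => k'; rewrite mcoeffZ !mcoeffU mulr_natr.
by rewrite scalarZ.
Qed.

Lemma moment_mone (d : measure_display) (T : measurableType d) (R : realType)
    (P : probability T R) (A : choiceType) (X : A -> {RV P >-> R}) :
  moment X mone = 1.
Proof.
rewrite /moment mdom1; under [X in expectation _ X]eq_fun do rewrite big_seq_fset0.
by rewrite expectation_cst.
Qed.

Theorem proposition3p7 (d : measure_display) (T : measurableType d)
    (R : realType) (P : probability T R) (A : choiceType)
    (X : A -> {RV P >-> R})
    (hX : forall (a : A) (n : nat), ('E_P[fun w => (`|X a w| ^+ n)%R] < +oo)%E) :
  let mu := moment_functional X in
  let kappa := cumulant_functional X in
  (forall h : {malg R[{cmonom A}]},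
    finite_set
      [set n : nat | (1 <= n)%N /\ convpow (mu \- counit) n h != 0]) /\
  (kappa : {malg R[{cmonom A}]} -> R) = logstar mu.
Proof.
move=> mu kappa; set f : {scalar {malg R[{cmonom A}]}} := mu \- counit.
have f1 : f << mone >> = 0.
  by rewrite /f /mu /= /counit !dualextU moment_mone eqxx subrr.
(* The largest degree in the support of [h] bounds the nonzero terms, which gives finiteness and the
   common truncation [N]. *)
have convpow0 h n : ((\max_(C <- msupp h) mdeg C) < n)%N -> convpow f n h = 0.
  move=> hn; rewrite scalar_malgE big_seq big1// => C Ch.
  rewrite convpow_order ?mulr0// (leq_ltn_trans _ hn)//.
  by apply: leq_bigmax_seq.
split=> [h|].
  apply: (sub_finite_set _ (finite_II (\max_(C <- msupp h) mdeg C)%N.+1)).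
  move=> n [_ /= /eqP fn]; rewrite ltnNge; apply/negP => hn.
  exact/fn/convpow0.
apply/funext => h; set N := (\max_(C <- msupp h) mdeg C)%N.
rewrite /logstar -/f -(fsbig_widen [set` index_iota 1 N.+1]); first last.
- move=> n [/= n1]; rewrite mem_index_iota n1 /= => /negP; rewrite -leqNgt => Nn.
  by rewrite /= convpow0 ?mulr0.
- by move=> n; rewrite /= mem_index_iota => /andP[].
rewrite -fsbig_seq ?iota_uniq//.
under eq_bigr do rewrite scalar_malgE mulr_sumr.
rewrite exchange_big scalar_malgE; apply: eq_big_seq => C Ch /=.
rewrite /kappa dualextU.
rewrite (@cumulant_log _ _ (moment X) _ C N (moment_mone X)).
- by rewrite mulr_sumr; apply: eq_bigr => n _; rewrite mulrCA.
- exact: cumulant_ofP.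
- exact: leq_bigmax_seq.
Qed.
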